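(* Let $k\ge 1$ and let $X_1,\dots,X_k$ be pairwise disjoint finite nonempty sets with $|X_i|=n_i$. Let $\mathrm{EC}$ be the set of eventually constant $k$-tuples $f=(f_1,\dots,f_k)$ of functions $f_i:X_i\to X_{i+1}$ (indices modulo $k$), and let $P(\mathbf x)=\sum_{f\in\mathrm{EC}}w(f)$. Then $$P(\mathbf x)=\prod_{i=1}^k e_1(X_i)^{n_{i-1}-2}\left(\prod_{j=1}^k e_1(X_j)^2-2^k\prod_{j=1}^k e_2(X_j)\right),$$ where indices are modulo $k$, so that $n_{1-1}=n_k$.
   Context: Indices are modulo $k$, so $X_{k+1}=X_1$ and $n_0=n_k$. A $k$-tuple $(f_1,\dots,f_k)$ with $f_i:X_i\to X_{i+1}$ is eventually constant if the iterates of the composition $f_k\cdots f_1:X_1\to X_1$ eventually stabilize to a constant map, i.e. $(f_k\cdots f_1)^m$ is constant for some $m\ge1$. There is one commuting variable $x_v$ for each $v\in X=\bigsqcup_i X_i$. The weight of a $k$-tuple is $w(f)=\prod_{i=1}^k\prod_{v\in X_i}x_{f_i(v)}$. For a vertex set $U$, $e_j(U)=\sum_{S\subseteq U,\,|S|=j}\prod_{v\in S}x_v$ is the $j$-th elementary symmetric polynomial. Where an exponent is negative, the identity is read in the field of rational functions in the $x_v$. *)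

(* Defs.v *)
From HB Require Import structures.
From mathcomp Require Import all_boot all_order all_algebra.
From mathcomp Require Import mpoly.

Set Implicit Arguments.
Unset Strict Implicit.
Unset Printing Implicit Defensive.

Import GRing.Theory.

(* Indices modulo k are elements of 'I_k, with cyclic successor [ordS] and
   predecessor [ord_pred]. The X_i are finite types, so that their disjoint
   union is the sigma type. *)
Definition vertex (k : nat) (X : 'I_k -> finType) : finType :=
  {i : 'I_k & X i}.

Definition vertices_of (k : nat) (X : 'I_k -> finType) (i : 'I_k) :
    {set vertex X} :=
  [set v : vertex X | tag v == i].

Definition cyclic_tuple (k : nat) (X : 'I_k -> finType) : finType :=
  {dffun forall i : 'I_k, {ffun X i -> X (ordS i)}}.

Section EventuallyConstant.

Variables (k : nat) (X : 'I_k -> finType).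

Definition step (f : cyclic_tuple X) (v : vertex X) : vertex X :=
  Tagged X (f (tag v) (tagged v)).

Lemma tag_iter_step (f : cyclic_tuple X) (m : nat) (v : vertex X) :
  tag (iter m (step f) v) = (tag v + m) %% k :> nat.
Proof.
elim: m => [|m IHm]; first by rewrite addn0 modn_small.
by rewrite iterS /= IHm -addn1 modnDml addn1 addnS.
Qed.

Lemma tag_cycle (f : cyclic_tuple X) (i : 'I_k) (v : X i) :
  tag (iter k (step f) (Tagged X v)) = i.
Proof. by apply: val_inj; rewrite /= tag_iter_step /= modnDr modn_small. Qed.

(* The map X_i -> X_i going once around the cycle; for the first index it is
   f_k ... f_1. Since X_(i+k) is only propositionally equal to X_i, the
   composite is computed in the disjoint union and then cast back to X_i. *)
Definition cycle_map (f : cyclic_tuple X) (i : 'I_k) (v : X i) : X i :=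
  etagged (tag_cycle f v).

Lemma cycle_mapE (f : cyclic_tuple X) (i : 'I_k) (v : X i) :
  Tagged X (cycle_map f v) = iter k (step f) (Tagged X v).
Proof. exact: etaggedK. Qed.

Definition constant_map (S T : Type) (g : S -> T) : Prop :=
  exists c : T, forall v : S, g v = c.

Definition eventually_constant (k_gt0 : 0 < k) (f : cyclic_tuple X) : Prop :=
  exists2 m : nat, (0 < m)%N &
    constant_map (iter m (@cycle_map f (Ordinal k_gt0))).

Lemma eventually_constant_dec (k_gt0 : 0 < k) (f : cyclic_tuple X) :
  decidable (eventually_constant k_gt0 f).
Proof.
set i := Ordinal k_gt0; set g := @cycle_map f i.
pose G (h : {ffun X i -> X i}) : {ffun X i -> X i} := [ffun v => g (h v)].
pose g0 : {ffun X i -> X i} := [ffun v => g v].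
have iterG m v : iter m G g0 v = iter m.+1 g v.
  by elim: m v => [|m IHm] v /=; rewrite ffunE // IHm.
apply: (@decP _ [exists h : {ffun X i -> X i},
  fconnect G g0 h && [exists c, forall v, h v == c]]).
apply: (iffP existsP) => [[h /andP[g0h /existsP[c /forallP hc]]]|].
  exists (findex G g0 h).+1 => //; exists c => v.
  by rewrite -iterG iter_findex //; apply/eqP.
case=> [[//|m] _ [c gc]]; exists (iter m G g0); rewrite fconnect_iter.
by apply/existsP; exists c; apply/forallP => v; rewrite iterG; apply/eqP.
Qed.

Definition EC (k_gt0 : 0 < k) : {set cyclic_tuple X} :=
  [set f | eventually_constant_dec k_gt0 f].

Lemma in_EC (k_gt0 : 0 < k) (f : cyclic_tuple X) :
  reflect (eventually_constant k_gt0 f) (f \in EC k_gt0).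
Proof. by rewrite inE; case: eventually_constant_dec => h; constructor. Qed.

End EventuallyConstant.

(* One commuting variable for each v in X; the library numbers variables by
   ordinals, hence the [enum_rank] in [x_]. *)
Notation vpoly F X := {mpoly F[#|vertex X|]}.
Notation "p %:F" := (FracField.tofrac p) : ring_scope.

Section Polynomials.

Local Open Scope ring_scope.

Variables (F : fieldType) (k : nat) (X : 'I_k -> finType).

Definition x_ (v : vertex X) : vpoly F X := 'X_(enum_rank v).

Definition weight (f : cyclic_tuple X) : vpoly F X :=
  \prod_(i < k) \prod_(v : X i) x_ (Tagged X (f i v)).

Definition elem_sym (j : nat) (U : {set vertex X}) : vpoly F X :=
  \sum_(S : {set vertex X} | (S \subset U) && (#|S| == j)) \prod_(v in S) x_ v.

Definition EC_poly (k_gt0 : (0 < k)%N) : vpoly F X :=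
  \sum_(f in EC X k_gt0) weight f.

End Polynomials.

(* Main.v *)
(* If some X_i is a singleton, every tuple is eventually constant and
   e_2(X_i) = 0. Otherwise fix distinct points c_i, d_i in each X_i. The
   right-hand side is then the total weight of the "colliding" tuples, those
   with f_i(c_i) = f_i(d_i) for some i: the weight of the complement is a product
   over i, since 2 e_2 = e_1^2 - sum x_v^2. So it suffices to show that the
   colliding tuples have the same total weight as the eventually constant ones.
   Neither class contains a tuple of bijections. For a proper subset B of the
   vertices, whether a tuple with image inside B is eventually constant depends
   only on its restriction to B, so by induction on the number of vertices the
   two classes have equal weight among the tuples with image inside B, hence
   (inclusion-exclusion) among those with image exactly B; now sum over B. *)
Require Import Defs.
From HB Require Import structures.
From mathcomp Require Import all_boot all_order all_algebra.
From mathcomp Require Import mpoly ring.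

Set Implicit Arguments.
Unset Strict Implicit.
Unset Printing Implicit Defensive.

Import GRing.Theory.
Local Open Scope ring_scope.

Lemma familyPP (V : finType) (P : V -> pred V) (g : {ffun V -> V}) :
  reflect (forall v, P v (g v)) (g \in family P).
Proof. exact: forallP. Qed.

(** * Maps over the index map [s] whose iterates merge the points of each fibre *)

Section Merging.

Variables (V I : finType) (t : V -> I) (s : I -> I).
Implicit Types (D B : {set V}) (g h : {ffun V -> V}).

Definition fib D i := [set v in D | t v == i].

Definition arrows D B v : pred V :=
  [pred w | if v \in D then w \in fib B (s (t v)) else w == v].

(* A tuple of functions from D to B is encoded as one endofunction of V that is
   the identity outside D. *)
Definition maps D B := family (arrows D B).

(** The condition that some iterate of [g] identifies [u] and [v], made boolean as reachability of
    the diagonal under the product map. *)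
Definition coalesce g u v :=
  [exists w, fconnect (fun p : V * V => (g p.1, g p.2)) (u, v) (w, w)].

Definition merging D g :=
  [forall u in D, forall v in D, (t u == t v) ==> coalesce g u v].

Lemma coalesceP g u v :
  reflect (exists m, iter m g u = iter m g v) (coalesce g u v).
Proof.
have iterE m : iter m (fun p : V * V => (g p.1, g p.2)) (u, v)
               = (iter m g u, iter m g v).
  by elim: m => //= m ->.
apply: (iffP existsP) => [[w /iter_findex]|[m guv]].
  rewrite iterE => -[gu gv].
  exists (findex (fun p : V * V => (g p.1, g p.2)) (u, v) (w, w)).
  by rewrite gu gv.
by exists (iter m g u); rewrite {2}guv -iterE fconnect_iter.
Qed.

Lemma mergingP D g :
  reflect {in D &, forall u v, t u = t v -> exists m, iter m g u = iter m g v}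
          (merging D g).
Proof.
apply: (iffP idP) => [gD u v uD vD tuv|gD].
  have /forall_inP/(_ v vD) := forall_inP gD u uD.
  by rewrite tuv eqxx => /coalesceP.
apply/forall_inP => u uD; apply/forall_inP => v vD; apply/implyP => /eqP tuv.
by apply/coalesceP/gD.
Qed.

Lemma fib_sub D B i : B \subset D -> fib B i \subset fib D i.
Proof.
by move=> /subsetP BD; apply/subsetP=> v; rewrite !inE => /andP[/BD->].
Qed.

Lemma mapsP D B g :
  reflect ({in D, forall v, g v \in B /\ t (g v) = s (t v)} /\
           forall v, v \notin D -> g v = v)
          (g \in maps D B).
Proof.
apply: (iffP (familyPP (arrows D B) g)) => [gP|[gD gN] v].
  split=> v; have := gP v; rewrite /arrows /=; case: ifP => // vD.
    by rewrite inE => /andP[-> /eqP].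
  by move=> /eqP.
rewrite /arrows /=; case: ifPn => [/gD[gB tg]|/gN ->//].
by rewrite inE gB tg /=.
Qed.

Lemma iter_maps D g v m : g \in maps D D -> v \in D ->
  iter m g v \in D /\ t (iter m g v) = iter m s (t v).
Proof.
move=> /mapsP[gD _] vD; elim: m => //= m [giD tgi].
by have [-> ->] := gD _ giD; rewrite tgi.
Qed.

(** One step of [g] carries [D] into [B] and keeps fibres together, so coalescence on [D] costs at
    most one iteration more than on [B]. *)
Lemma merging_image D B g : B \subset D -> g \in maps D B ->
  merging D g = merging B g.
Proof.
move=> /subsetP BD /mapsP[gD _]; apply/mergingP/mergingP => gm u v uD vD tuv.
  by apply: gm => //; apply: BD.
have [[guB tgu] [gvB tgv]] := (gD u uD, gD v vD).
have [|m gm1] := gm (g u) (g v) guB gvB; first by rewrite tgu tgv tuv.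
by exists m.+1; rewrite !iterSr.
Qed.

Lemma eq_merging B g h : {in B, forall v, g v \in B} -> {in B, g =1 h} ->
  merging B g = merging B h.
Proof.
move=> gB gh.
have iterE v m : v \in B -> iter m g v \in B /\ iter m g v = iter m h v.
  move=> vB; elim: m => //= m [gm ghm].
  by rewrite gB // gh // -ghm.
apply/mergingP/mergingP => gm u v uB vB tuv; have [m E] := gm u v uB vB tuv;
  exists m; move: E; by rewrite !(iterE _ m _).2.
Qed.

(** Since [i] is reachable from every index, some number of steps takes any whole fibre into the
    fibre over [i], where there is no room for two points. *)
Lemma merging_fib1 D g i : (forall j, fconnect s j i) -> g \in maps D D ->
  (#|fib D i| <= 1)%N -> merging D g.
Proof.
move=> si gD Di; apply/mergingP => u v uD vD tuv.
pose m := findex s (t u) i.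
have inD w : w \in D -> t w = t u -> iter m g w \in fib D i.
  move=> wD tw; have [gw tgw] := iter_maps m gD wD.
  by rewrite inE gw tgw tw iter_findex ?eqxx.
by exists m; apply: (card_le1_eqP Di); apply: inD.
Qed.

(** A map of [D] onto itself is injective on [D], so two points of a fibre stay distinct under all
    iterates. *)
Lemma merging_onto D g i : g \in maps D D -> g @: D = D ->
  (1 < #|fib D i|)%N -> ~~ merging D g.
Proof.
move=> gD gDD /card_gt1P[u [v [uD vD uv]]]; apply/negP => /mergingP gm.
have g_inj : {in D &, injective g} by apply/imset_injP; rewrite gDD.
have [uD' /eqP tu] : u \in D /\ t u == i by move: uD; rewrite inE => /andP.
have [vD' /eqP tv] : v \in D /\ t v == i by move: vD; rewrite inE => /andP.
have [|m] := gm u v uD' vD'; first by rewrite tu tv.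
elim: m => [/eqP|m IHm /= /g_inj E]; first exact/negP.
by apply: IHm; apply: E; apply: (iter_maps _ gD _).1.
Qed.

(** * Weight sums over families of functions *)

Lemma eq_family (P Q : V -> pred V) : (forall v, P v =1 Q v) ->
  family P =i family Q.
Proof.
by move=> PQ g; apply/familyPP/familyPP => gP v; have := gP v; rewrite PQ.
Qed.

(** [family (fixed_on U P)] represents the choices of values outside [U]: the identity on [U] is a
    placeholder that makes the representative unique. *)
Definition fixed_on (U : {set V}) (P : V -> pred V) v : pred V :=
  fun w => if v \in U then w == v else P v w.

Definition fiber_over (U : {set V}) (P : V -> pred V) h v : pred V :=
  fun w => if v \in U then P v w else w == h v.

(* Fubini: choose the values outside U first (h), then those on U (g). *)
Lemma family_split (R : nmodType) (U : {set V}) (P : V -> pred V)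
    (K : {ffun V -> V} -> R) :
  \sum_(g in family P) K g =
  \sum_(h in family (fixed_on U P)) \sum_(g in family (fiber_over U P h)) K g.
Proof.
pose r g := [ffun v => if v \in U then v else g v].
rewrite (partition_big r (mem (family (fixed_on U P)))) => [|g /familyPP gP].
  apply: eq_bigr => h /familyPP hP; apply: eq_bigl => g.
  apply/andP/familyPP => [[/familyPP gP /eqP <-] v|gP].
    by rewrite /fiber_over ffunE; case: (v \in U).
  split; first apply/familyPP => v.
    move: (gP v) (hP v); rewrite /fiber_over /fixed_on.
    by case: (v \in U) => // /eqP->.
  apply/eqP/ffunP => v; rewrite ffunE; move: (gP v) (hP v).
  by rewrite /fiber_over /fixed_on; case: (v \in U) => [_ /eqP|/eqP].
apply/familyPP => v; rewrite /fixed_on ffunE.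
by move: (gP v); case: (v \in U).
Qed.

Variables (R : comNzRingType) (x : V -> R).

Definition wt D g := \prod_(v in D) x (g v).
Definition psum r B i := \sum_(v in fib B i) x v ^+ r.

(* If [#|fib D i| = 1] the exponent is truncated to 0, which is harmless: for B
   inside D the other factor [psum 1 ^+ 2 - psum 2] vanishes at some index. *)
Definition closed_form D B :=
  \prod_i psum 1 B (s i) ^+ #|fib D i| -
  \prod_i (psum 1 B (s i) ^+ (#|fib D i| - 2) *
           (psum 1 B (s i) ^+ 2 - psum 2 B (s i))).

Lemma psum1E B i : psum 1 B i = \sum_(v in fib B i) x v.
Proof. by apply: eq_bigr => v _; rewrite expr1. Qed.

Lemma sum_wt D (P : V -> pred V) :
  \sum_(g in family P) wt D g =
  \prod_v \sum_(w | P v w) (if v \in D then x w else 1).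
Proof.
rewrite bigA_distr_big_dep; apply: eq_bigr => g _.
by rewrite /wt big_mkcond.
Qed.

Lemma prod_fib D (G : I -> R) :
  \prod_(v in D) G (t v) = \prod_i G i ^+ #|fib D i|.
Proof.
rewrite (partition_big t xpredT) //=; apply: eq_bigr => i _.
rewrite -prodr_const; apply: eq_big => [v|v /andP[_ /eqP->//]].
by rewrite !inE.
Qed.

Lemma sum_arrows D B v :
  \sum_(w | arrows D B v w) (if v \in D then x w else 1) =
  if v \in D then psum 1 B (s (t v)) else 1.
Proof.
rewrite /arrows /=; case: ifP => vD; last by rewrite big_pred1_eq.
by rewrite psum1E.
Qed.

Lemma sum_wt_maps D B :
  \sum_(g in maps D B) wt D g = \prod_i psum 1 B (s i) ^+ #|fib D i|.
Proof.
rewrite sum_wt -(prod_fib D (fun i => psum 1 B (s i))) [RHS]big_mkcond.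
by apply: eq_bigr => v _; rewrite sum_arrows.
Qed.

Lemma prod_section (c : I -> V) (G : I -> R) : (forall i, t (c i) = i) ->
  \prod_v (if v == c (t v) then G (t v) else 1) = \prod_i G i.
Proof.
move=> tc; rewrite -big_mkcond (reindex_onto c t) => [|v /eqP<-//].
by apply: eq_big => [i|i _]; rewrite tc ?eqxx.
Qed.

Definition merging_sum D B := \sum_(g in maps D B | merging D g) wt D g.

(** Merging is decided by the restriction to [B]; the values on [D :\: B] are then free, and each
    such vertex [v] contributes a factor [psum 1 B (s (t v))]. *)
Lemma merging_sum_restrict D B : B \subset D ->
  merging_sum D B =
  (\prod_i psum 1 B (s i) ^+ (#|fib D i| - #|fib B i|)) * merging_sum B B.
Proof.
move=> BD; have BDs := subsetP BD.
rewrite /merging_sum big_mkcondr /= (family_split (D :\: B)).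
rewrite mulr_sumr [RHS]big_mkcondr /=.
apply: eq_big => [h|h hP].
  apply: eq_family => v w; rewrite /fixed_on /arrows /= !inE.
  case vB: (v \in B); case vD: (v \in D) => //=.
  by rewrite BDs in vD.
have {}hP : h \in maps B B.
  move: hP; congr (is_true _); apply: eq_family => v w.
  rewrite /fixed_on /arrows /= !inE.
  case vB: (v \in B); case vD: (v \in D) => //=.
  by rewrite BDs in vD.
set P := fiber_over _ _ _.
have gP g : g \in family P -> g \in maps D B /\ {in B, g =1 h}.
  move=> /familyPP gP; split.
    apply/familyPP => v; move: (gP v); rewrite /P /fiber_over /arrows /= !inE.
    case vB: (v \in B); case vD: (v \in D) => //=.
    - by move/eqP->; have [/(_ v vB)[-> ->] _] := mapsP _ _ _ hP; rewrite eqxx.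
    - by rewrite BDs in vD.
    - by move/eqP->; have [_ /(_ v)->] := mapsP _ _ _ hP; rewrite ?vB.
  by move=> v vB; move: (gP v); rewrite /P /fiber_over /arrows /= !inE vB => /eqP.
transitivity (\sum_(g in family P) if merging B h then wt D g else 0).
  apply: eq_bigr => g /gP[gD gh].
  rewrite (merging_image BD gD) (eq_merging _ gh) //.
  move=> v vB; have [/(_ v (BDs v vB))[]] // := mapsP _ _ _ gD.
case: ifP => _; last by rewrite big1.
rewrite sum_wt /wt.
have <- : \prod_(v in D :\: B) psum 1 B (s (t v)) =
  \prod_i psum 1 B (s i) ^+ (#|fib D i| - #|fib B i|).
  rewrite (prod_fib _ (fun i => psum 1 B (s i))); apply: eq_bigr => i _.
  congr (_ ^+ _).
  have -> : fib (D :\: B) i = fib D i :\: fib B i.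
    apply/setP => v; rewrite !inE.
    by case: (v \in B); case: (_ == _); rewrite ?andbF.
  by rewrite cardsD (setIidPr (fib_sub i BD)).
rewrite [\prod_(v in _ :\: _) _]big_mkcond [\prod_(v in B) _]big_mkcond.
rewrite -big_split /=; apply: eq_bigr => v _.
rewrite /P /fiber_over inE; case vB: (v \in B) => /=.
  by rewrite big_pred1_eq BDs // mul1r.
case vD: (v \in D); last by rewrite big_pred1_eq mulr1.
rewrite mulr1 psum1E; apply: eq_bigl => w.
by rewrite /arrows /= vD.
Qed.

(** * Total weight of the colliding maps *)

Definition colliding (c d : I -> V) g := [exists i, g (c i) == g (d i)].

(** The value at [d i] is chosen last: it must avoid [g (c i)], which leaves the factor
    [psum 1 B (s i) - x (g (c i))]. Summing this against [x (g (c i))] gives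
    [psum 1 B (s i) ^+ 2 - psum 2 B (s i)]; the other [#|fib D i| - 2] points are free. *)
Lemma noncolliding_sum D B (c d : I -> V) :
  (forall i, [/\ c i \in fib D i, d i \in fib D i & c i != d i]) ->
  \sum_(g in maps D B | ~~ colliding c d g) wt D g =
  \prod_i (psum 1 B (s i) ^+ (#|fib D i| - 2) *
           (psum 1 B (s i) ^+ 2 - psum 2 B (s i))).
Proof.
move=> cdP.
have cD i : c i \in D by have [] := cdP i; rewrite inE => /andP[].
have dD i : d i \in D by have [_] := cdP i; rewrite inE => /andP[].
have tc i : t (c i) = i by have [] := cdP i; rewrite inE => /andP[_ /eqP].
have td i : t (d i) = i by have [_] := cdP i; rewrite inE => /andP[_ /eqP].
have cNd v : v == c (t v) -> (v == d (t v)) = false.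
  by move/eqP->; rewrite tc; have [_ _ /negPf] := cdP (t v).
pose U := [set v | v == d (t v)].
pose P h v : pred V := fun w => if v \in U
  then arrows D B v w && (w != h (c (t v))) else w == h v.
(* [G] charges the factor coming from [d i] to the vertex [c i], where the value it depends on is
   chosen; the vertices in [U] are left with weight 1. *)
pose G v w : R := if v \in U then 1 else
  if v == c (t v) then x w * (psum 1 B (s (t v)) - x w) else
  if v \in D then x w else 1.
transitivity (\sum_(h in family (fixed_on U (arrows D B))) \prod_v G v (h v)).
  rewrite big_mkcondr /= (family_split U); apply: eq_bigr => h /familyPP hP.
  rewrite -big_mkcondr.
  transitivity (\sum_(g in family (P h)) wt D g).
    apply: eq_bigl => g; apply/andP/familyPP => [[/familyPP gP gcd] v|gP].
      have := gP v; rewrite /P /fiber_over; case: ifPn => // vU ->/=.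
      have := gP (c (t v)); rewrite /fiber_over inE tc.
      have [_ _ /negPf->] := cdP (t v) => /eqP <-.
      apply: contraNneq gcd => gcd; apply/existsP; exists (t v).
      by rewrite -gcd eq_sym; move: vU; rewrite inE => /eqP<-.
    split; first apply/familyPP => v.
      by have := gP v; rewrite /P /fiber_over; case: ifP => // _ /andP[].
    apply/existsPn => i; have := gP (c i); have := gP (d i).
    rewrite /P !inE tc td eqxx; have [_ _ /negPf->] := cdP i.
    by move=> /andP[_ gd] /eqP ->; rewrite eq_sym.
  rewrite sum_wt.
  transitivity (\prod_v
    ((if v == d (t v) then psum 1 B (s (t v)) - x (h (c (t v))) else 1) * if v \in D :\: U then x (h v) else 1)).
    apply: eq_bigr => v _; rewrite /P !inE.
    case: ifPn => [/eqP vd|vd]; last by rewrite big_pred1_eq mul1r.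
    have vD : v \in D by rewrite vd.
    rewrite vD /= mulr1 psum1E.
    rewrite [in RHS](bigD1 (h (c (t v)))) /=; last first.
      have := hP (c (t v)); rewrite /fixed_on /arrows /= !inE tc cD.
      by have [_ _ /negPf->] := cdP (t v).
    rewrite addrAC subrr add0r; apply: eq_bigl => w.
    by rewrite /arrows /= vD.
  rewrite big_split /=.
  rewrite (prod_section (fun i => psum 1 B (s i) - x (h (c i))) td).
  rewrite -(prod_section (fun i => psum 1 B (s i) - x (h (c i))) tc).
  rewrite -big_split /=; apply: eq_bigr => v _; rewrite /G !inE.
  case: ifPn => [/eqP vc|vc].
    have vD : v \in D by rewrite vc.
    by rewrite (cNd v) -?vc //= vD mulrC.
  by case: (v == d (t v)) => /=; rewrite mul1r.
rewrite -(bigA_distr_big_dep _ G).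
rewrite (partition_big t xpredT) //=; apply: eq_bigr => i _.
rewrite (bigD1 (d i)) ?td //= [X in _ * X](bigD1 (c i)) ?tc ?eqxx //=; last first.
  by have [_ _] := cdP i.
have cU : (c i \in U) = false.
  by rewrite inE tc; have [_ _ /negPf] := cdP i.
rewrite (_ : \sum_(w | _ (d i) w) _ = 1); last first.
  rewrite (big_pred1 (d i)) => [|w]; first by rewrite /G inE td eqxx.
  by rewrite /fixed_on inE td eqxx.
rewrite (_ : \sum_(w | _ (c i) w) _ = psum 1 B (s i) ^+ 2 - psum 2 B (s i));
  last first.
  rewrite psum1E expr2 mulr_suml -sumrB.
  apply: eq_big => [w|w _]; first by rewrite /fixed_on cU /arrows /= cD tc.
  by rewrite /G cU tc eqxx psum1E mulrBr expr2.
rewrite mul1r mulrC; congr (_ * _).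
have -> : (#|fib D i| - 2)%N = #|fib D i :\ d i :\ c i|.
  have [ciD diD cd] := cdP i.
  rewrite (cardsD1 (d i)) (cardsD1 (c i) (_ :\ _)) diD in_setD1 cd ciD.
  by rewrite !add1n !subSS subn0.
rewrite -prodr_const big_mkcond [RHS]big_mkcond /=; apply: eq_bigr => v _.
rewrite !inE; case: (eqVneq (t v) i) => [tv|]; last by rewrite !andbF.
rewrite andbT -tv; case: (eqVneq v (d _)) => [|vd]; first by rewrite /= andbF.
case: (eqVneq v (c _)) => //= vc.
rewrite -sum_arrows; apply: eq_big => [w|w _].
  by rewrite /fixed_on inE (negPf vd).
by rewrite /G inE (negPf vd) (negPf vc).
Qed.

Lemma colliding_sum D B (c d : I -> V) :
  (forall i, [/\ c i \in fib D i, d i \in fib D i & c i != d i]) ->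
  \sum_(g in maps D B | colliding c d g) wt D g = closed_form D B.
Proof.
move=> cdP; rewrite /closed_form -sum_wt_maps -(noncolliding_sum B cdP).
by rewrite [X in X - _](bigID (colliding c d)) /= addrK.
Qed.

(** * Sorting maps by image, and inversion of subset sums *)

Lemma sum_by_image D B (phi : pred {ffun V -> V}) : B \subset D ->
  \sum_(g in maps D B | phi g) wt D g =
  \sum_(A : {set V} | A \subset B)
    \sum_(g in maps D D | phi g && (g @: D == A)) wt D g.
Proof.
move=> BD; rewrite (partition_big (fun g : {ffun V -> V} => g @: D)
                                  (fun A => A \subset B)).
  apply: eq_bigr => A AB; apply: eq_bigl => g; rewrite -andbA.
  case: eqP => [gA|]; last by rewrite !andbF.
  congr (_ && _); apply/mapsP/mapsP => -[gD gN]; split=> // v vD;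
    have [gB tg] := gD v vD; split=> //.
    exact: (subsetP BD).
  by apply: (subsetP AB); rewrite -gA imset_f.
move=> g /andP[/mapsP[gD _] _]; apply/subsetP => _ /imsetP[v vD ->].
by have [] := gD v vD.
Qed.

(** Inclusion-exclusion without signs: strong induction on the size of [B] cancels the terms of all
    its proper subsets. *)
Lemma eq_subset_sums D (f1 f2 : {set V} -> R) :
  (forall B : {set V}, B \proper D ->
    \sum_(A : {set V} | A \subset B) f1 A =
    \sum_(A : {set V} | A \subset B) f2 A) ->
  forall B : {set V}, B \proper D -> f1 B = f2 B.
Proof.
move=> f12 B; have [n] := ubnP #|B|; elim: n B => // n IHn B Bn BD.
have := f12 B BD; rewrite (bigD1 B) // [RHS](bigD1 B) //=.
rewrite (eq_bigr f2) => [/addIr//|A /andP[AB nAB]].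
have AB' : A \proper B by rewrite properEneq nAB.
apply: IHn; last exact: proper_trans BD.
exact: leq_trans (proper_card AB') Bn.
Qed.

Lemma psum_fib1 B i : (#|fib B i| <= 1)%N -> psum 1 B i ^+ 2 = psum 2 B i.
Proof.
rewrite psum1E /psum leq_eqVlt ltnS leqn0.
case/orP=> [/cards1P[v ->]|]; first by rewrite !big_set1.
by rewrite cards_eq0 => /eqP->; rewrite !big_set0 expr0n.
Qed.

(** * Equality of the merging weight with the closed form *)

Hypothesis s_trans : forall i j, fconnect s i j.

Lemma s_surj i : exists j, s j = i.
Proof.
exists (iter (findex s (s i) i) s i).
by rewrite -iterS iterSr iter_findex.
Qed.

(** As [s] is surjective, the fibre over [i] occurs as a target, and [psum_fib1] makes the
    corresponding factor of the subtracted product zero. *)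
Lemma closed_form_fib1 D B i : (#|fib B i| <= 1)%N ->
  closed_form D B = \prod_i psum 1 B (s i) ^+ #|fib D i|.
Proof.
move=> Bi; have [j sj] := s_surj i.
rewrite /closed_form [X in _ - X](bigD1 j) //=.
by rewrite sj psum_fib1 // subrr mulr0 mul0r subr0.
Qed.

(** The exponents add up. In the second product this needs at least two points in every fibre of
    [B], because subtraction is truncated; otherwise that product vanishes on both sides. *)
Lemma closed_form_restrict D B : B \subset D ->
  (\prod_i psum 1 B (s i) ^+ (#|fib D i| - #|fib B i|)) * closed_form B B =
  closed_form D B.
Proof.
move=> BD; have le_fib i : (#|fib B i| <= #|fib D i|)%N.
  by rewrite subset_leq_card ?fib_sub.
have [/existsP[i Bi]|/existsPn B2] := boolP [exists i, (#|fib B i| <= 1)%N].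
  rewrite !(closed_form_fib1 _ Bi) -big_split /=; apply: eq_bigr => j _.
  by rewrite -exprD subnK.
rewrite /closed_form mulrBr -!big_split /=; congr (_ - _);
  apply: eq_bigr => i _; rewrite ?mulrA -exprD ?subnK //.
by rewrite addnBA ?subnK // ltnNge B2.
Qed.

(** Strong induction on the size of [D]. If some fibre is a singleton, all maps merge and the closed
    form is their total weight; otherwise merging and colliding maps are compared image by image. *)
Lemma merging_sum_closed D : I -> (forall i, (0 < #|fib D i|)%N) ->
  merging_sum D D = closed_form D D.
Proof.
move=> i0; have [n] := ubnP #|D|; elim: n D => // n IHn D Dn D_gt0.
have [/existsP[i Di]|/existsPn D2] := boolP [exists i, (#|fib D i| <= 1)%N].
  rewrite (closed_form_fib1 _ Di) -sum_wt_maps /merging_sum.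
  apply: eq_bigl => g; case gD: (g \in maps D D) => //=.
  by rewrite (@merging_fib1 _ _ i).
have D_gt1 i : (1 < #|fib D i|)%N by rewrite ltnNge.
have cd_ex i : {cd : V * V |
    [&& cd.1 \in fib D i, cd.2 \in fib D i & cd.1 != cd.2]}.
  apply: sigW; have /card_gt1P[u [v [uD vD uv]]] := D_gt1 i.
  by exists (u, v); rewrite uD vD uv.
pose c i := (sval (cd_ex i)).1; pose d i := (sval (cd_ex i)).2.
have cdP i : [/\ c i \in fib D i, d i \in fib D i & c i != d i].
  by rewrite /c /d; case: (cd_ex i) => cd /= /and3P.
rewrite -(colliding_sum D cdP) /merging_sum !(sum_by_image _ (subxx D)).
(* For the image [D] both sums are empty: a colliding map is not injective on [D], and a merging one
   is not onto. *)
apply: eq_bigr => A AD; have [->|nAD] := eqVneq A D.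
  rewrite !big1 // => g /and3P[gD phi /eqP gDD].
    case/existsP: phi => i /eqP gcd; have [ci di /eqP[]] := cdP i.
    have /imset_injP g_inj : #|g @: D| == #|D| by rewrite gDD.
    by apply: g_inj gcd; [move: ci | move: di]; rewrite inE => /andP[].
  by have := merging_onto gD gDD (D_gt1 i0); rewrite phi.
have {AD}AD : A \proper D by rewrite properEneq nAD.
move: A AD {nAD}; apply: eq_subset_sums => B BD; have /andP[BsD _] := BD.
rewrite -!(sum_by_image _ BsD) (colliding_sum _ cdP) -/(merging_sum D B).
(* If [B] has an empty fibre the induction hypothesis does not apply, but both sides are 0:
   [maps D B] is empty, and the closed form has a factor 0 with positive exponent. *)
have [/existsP[i /eqP Bi0]|/existsPn B_gt0] :=
  boolP [exists i, #|fib B i| == 0%N].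
  rewrite (closed_form_fib1 _ (_ : #|fib B i| <= 1)%N) ?Bi0 //.
  have [j sj] := s_surj i; rewrite (bigD1 j) //= sj psum1E.
  rewrite (cards0_eq Bi0) big_set0 expr0n eqn0Ngt D_gt0 mul0r.
  rewrite /merging_sum big_pred0 // => g; apply/negbTE; apply/negP.
  case/andP=> /mapsP[gD _] _; have /card_gt0P[v] := D_gt0 j.
  rewrite inE => /andP[/gD[gvB tg] /eqP tv]; have := cards0_eq Bi0.
  by move/setP/(_ (g v)); rewrite !inE gvB tg tv sj eqxx.
rewrite (merging_sum_restrict BsD) -(closed_form_restrict BsD).
congr (_ * _); apply: IHn => [|i]; last by rewrite lt0n B_gt0.
exact: leq_trans (proper_card BD) Dn.
Qed.

End Merging.

(** * Cyclic tuples as maps over the cyclic successor *)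

Lemma fconnect_ordS k (i j : 'I_k) : fconnect (@ordS k) i j.
Proof.
have val_iter m : iter m (@ordS k) i = ((i + m) %% k)%N :> nat.
  elim: m => [|m IHm]; first by rewrite addn0 modn_small.
  by rewrite iterS /= IHm -addn1 modnDml addn1 addnS.
(* From [i], [k - i] steps wrap around to 0, and [j] more reach [j]. *)
rewrite (_ : j = iter (j + (k - i))%N (@ordS k) i) ?fconnect_iter //.
apply: val_inj; rewrite /= val_iter addnCA subnKC 1?ltnW //.
by rewrite modnDr modn_small.
Qed.

Lemma Tagged_inj (I : eqType) (T : I -> eqType) i : injective (@Tagged I i T).
Proof. by move=> u v /eqP; rewrite eq_Tagged => /eqP. Qed.

Section Tuples.

Variables (k : nat) (X : 'I_k -> finType).
Implicit Types f : cyclic_tuple X.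

Local Notation tagV := (@tag 'I_k X).
Local Notation cyclic_maps := (maps tagV (@ordS k) setT setT).

Definition step_ffun f : {ffun vertex X -> vertex X} := [ffun v => step f v].

Lemma step_ffun_maps f : step_ffun f \in cyclic_maps.
Proof. by apply/mapsP; split=> v; rewrite ?inE // ffunE. Qed.

Lemma step_ffun_inj : injective step_ffun.
Proof.
move=> f1 f2 /ffunP f12; apply/ffunP => i; apply/ffunP => v.
by have := f12 (Tagged X v); rewrite !ffunE => /(@Tagged_inj _ X).
Qed.

Lemma step_ffun_surj g : g \in cyclic_maps -> exists f, step_ffun f = g.
Proof.
move=> /mapsP[gT _].
have tg i (v : X i) : tag (g (Tagged X v)) = ordS i.
  by have [] := gT (Tagged X v) (in_setT _).
exists [ffun i => [ffun v => etagged (tg i v)]].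
apply/ffunP => -[i v]; rewrite ffunE /step /= !ffunE.
exact: etaggedK.
Qed.

Lemma iter_step_ffun f m v : iter m (step_ffun f) v = iter m (step f) v.
Proof. by apply: eq_iter => u; rewrite ffunE. Qed.

Lemma iter_cycle_map f i m (v : X i) :
  Tagged X (iter m (@Defs.cycle_map k X f i) v) =
  iter (m * k)%N (step f) (Tagged X v).
Proof. by elim: m => // m IHm; rewrite iterS cycle_mapE IHm mulSn iterD. Qed.

Hypothesis k_gt0 : (0 < k)%N.
Hypothesis X_gt0 : forall i, (0 < #|X i|)%N.

(** Eventual constancy looks at the first index only, merging at all of them; they agree because
    every fibre is carried into the first one by finitely many steps. *)
Lemma EC_merging f : (f \in EC X k_gt0) = merging tagV setT (step_ffun f).
Proof.
pose i0 := Ordinal k_gt0.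
apply/in_EC/mergingP => [[m m_gt0 [c fc]] u v _ _ tuv|fm].
  pose r := findex (@ordS k) (tag u) i0.
  have to_c w : tag w = tag u -> iter (m * k + r) (step_ffun f) w = Tagged X c.
    move=> tw; rewrite iterD !iter_step_ffun.
    have tr : tag (iter r (step f) w) = i0.
      rewrite -(iter_findex (fconnect_ordS (tag u) i0)) -/r -tw.
      by elim: (r) => //= n ->.
    by rewrite -(etaggedK tr) -iter_cycle_map fc.
  by exists (m * k + r)%N; rewrite !to_c.
have {fm} [M fM] : exists M : X i0 * X i0 -> nat, forall p,
    iter (M p) (step_ffun f) (Tagged X p.1) =
    iter (M p) (step_ffun f) (Tagged X p.2).
  apply: (fin_all_exists (P := fun p m => iter m (step_ffun f) (Tagged X p.1) =
    iter m (step_ffun f) (Tagged X p.2))) => p.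
  by apply: fm; rewrite ?inE.
have /card_gt0P[v0 _] := X_gt0 i0.
(* The maximum serves all of the finitely many pairs at once; the successor makes the number of
   turns positive, and each turn has at least one step. *)
pose m := (\max_p M p).+1.
exists m => //; exists (iter m (@Defs.cycle_map k X f i0) v0) => v.
apply: (@Tagged_inj _ X).
rewrite !iter_cycle_map -!iter_step_ffun.
have le_M : (M (v, v0) <= m * k)%N.
  apply: leq_trans (leq_pmulr _ k_gt0).
  by rewrite leqW // (leq_bigmax (F := M) (v, v0)).
by rewrite -(subnK le_M) !iterD (fM (v, v0)).
Qed.

Variable F : fieldType.

Lemma EC_poly_closed_form :
  EC_poly F X k_gt0 = closed_form tagV (@ordS k) (@x_ F k X) setT setT.
Proof.
rewrite -merging_sum_closed; last first.
- move=> i; have /card_gt0P[v _] := X_gt0 i.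
  by apply/card_gt0P; exists (Tagged X v); rewrite !inE eqxx.
- exact: Ordinal k_gt0.
- exact: fconnect_ordS.
have imE : step_ffun @: EC X k_gt0 =i
    [pred g in cyclic_maps | merging tagV setT g].
  move=> g; apply/imsetP/andP => [[f fEC ->]|[/step_ffun_surj[f <-] fm]].
    by rewrite step_ffun_maps -EC_merging.
  by exists f; rewrite ?EC_merging.
rewrite /merging_sum -(eq_bigl _ _ imE) big_imset; last first.
  by move=> f1 f2 _ _; apply: step_ffun_inj.
apply: eq_bigr => f _; rewrite /weight /wt sig_big_dep /=.
by apply: eq_big => v; rewrite ?inE // ffunE.
Qed.

End Tuples.

(** * Elementary symmetric polynomials and power sums *)

Section ElemSym.

Variables (F : fieldType) (k : nat) (X : 'I_k -> finType).
Implicit Type U : {set vertex X}.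
Local Notation x := (@x_ F k X).

Lemma elem_sym1 U : elem_sym F 1 U = \sum_(v in U) x v.
Proof.
rewrite /elem_sym (eq_bigl (mem ((set1 : _ -> {set vertex X}) @: U))).
  rewrite big_imset /= => [|u v _ _ /set1_inj//].
  by apply: eq_bigr => v _; rewrite big_set1.
move=> S; apply/andP/imsetP => [[SU /cards1P[v Sv]]|[v vU ->]].
  by exists v; rewrite // -sub1set -Sv.
by rewrite sub1set cards1.
Qed.

(** Both sides sum [x u * x v] over ordered pairs of distinct elements of [U]; each two-element
    subset comes from two such pairs. *)
Lemma elem_sym2 U :
  2 * elem_sym F 2 U = (\sum_(v in U) x v) ^+ 2 - \sum_(v in U) x v ^+ 2.
Proof.
rewrite expr2 mulr_suml -sumrB.
transitivity (\sum_(p | [&& p.1 \in U, p.2 \in U & p.1 != p.2]) x p.1 * x p.2).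
  rewrite (partition_big (fun p => [set p.1; p.2])
             (fun S => (S \subset U) && (#|S| == 2%N))) => [|p /and3P[p1 p2 p12]].
    rewrite mulr_sumr; apply: eq_bigr => S /andP[SU /cards2P[a [b [ab SE]]]].
    have [aU bU] : a \in U /\ b \in U.
      by split; apply: (subsetP SU); rewrite SE !inE eqxx ?orbT.
    rewrite (bigD1 (a, b)) /=; last by rewrite aU bU ab -SE eqxx.
    rewrite (big_pred1 (b, a)) => [|[u v] /=].
      by rewrite SE big_setU1 ?inE //= big_set1; ring.
    apply/andP/eqP => [[/andP[/and3P[uU vU uv] /eqP uvS] nab]|[-> ->]].
      have uS : u \in [set a; b] by rewrite -SE -uvS !inE eqxx.
      have vS : v \in [set a; b] by rewrite -SE -uvS !inE eqxx orbT.
      move: nab uv; case/set2P: uS => ->; case/set2P: vS => ->;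
        by rewrite ?eqxx.
    by rewrite bU aU eq_sym ab setUC -SE xpair_eqE eq_sym (negPf ab) eqxx.
  by rewrite subUset !sub1set p1 p2 cards2 p12.
rewrite -(pair_big_dep (fun u => u \in U) (fun u v => (v \in U) && (u != v))
            (fun u v => x u * x v)) /=.
apply: eq_bigr => u uU; rewrite mulr_sumr [X in _ = X - _](bigD1 u) //=.
by rewrite expr2 addrC addrK; apply: eq_bigl => v; rewrite eq_sym.
Qed.

(** Evaluation at the indicator of [v] gives 1. The nonvanishing is what allows integer exponents to
    be added in the fraction field. *)
Lemma elem_sym1_neq0 U v : v \in U -> elem_sym F 1 U != 0.
Proof.
move=> vU; apply/eqP => /(congr1 (meval (fun j => (j == enum_rank v)%:R))).
rewrite elem_sym1 raddf_sum raddf0 (bigD1 v) //= mevalXU eqxx big1 => [|u].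
  by rewrite addr0 => /eqP; rewrite oner_eq0.
by case/andP=> _ uv; rewrite mevalXU (inj_eq enum_rank_inj) (negPf uv).
Qed.

Lemma elem_sym_eq0 j U : (#|U| < j)%N -> elem_sym F j U = 0.
Proof.
move=> Uj; rewrite /elem_sym big_pred0 // => S.
by apply/negP => /andP[/subset_leq_card SU /eqP Sj]; rewrite ltnNge -Sj SU in Uj.
Qed.

End ElemSym.

Theorem theorem1p1 (F : fieldType) (k : nat) (k_gt0 : (0 < k)%N)
    (X : 'I_k -> finType) (X_gt0 : forall i : 'I_k, (0 < #|X i|)%N) :
  let n (i : 'I_k) : int := #|X i|%:Z in
  let e (j : nat) (i : 'I_k) : {fraction vpoly F X} :=
    (elem_sym F j (vertices_of X i))%:F in
  (EC_poly F X k_gt0)%:F =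
    (\prod_(i < k) (e 1%N i) ^ (n (ord_pred i) - 2)) *
      ((\prod_(j < k) (e 1%N j) ^+ 2) - 2 ^+ k * (\prod_(j < k) e 2%N j))
    :> {fraction vpoly F X}.
Proof.
move=> n e.
have fibE i : fib (@tag _ X) setT i = vertices_of X i.
  by apply/setP => v; rewrite !inE.
have card_fib i : #|vertices_of X i| = #|X i|.
  rewrite -(card_imset xpredT (@Tagged_inj _ X i)); apply: eq_card => -[j v].
  rewrite inE /=; apply/eqP/imsetP => [ji|[u _ /(congr1 tag)//]].
  by case: _ / ji v => v; exists v.
have e1_neq0 i : e 1%N i != 0.
  have /card_gt0P[v _] := X_gt0 i.
  by rewrite tofrac_eq0 (@elem_sym1_neq0 _ _ _ _ (Tagged X v)) // inE.
have psum1_e1 i : psum (@tag _ X) (@x_ F k X) 1 setT i =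
    elem_sym F 1 (vertices_of X i).
  by rewrite psum1E fibE elem_sym1.
have psum2_e2 i : psum (@tag _ X) (@x_ F k X) 1 setT i ^+ 2 -
    psum (@tag _ X) (@x_ F k X) 2 setT i =
    2 * elem_sym F 2 (vertices_of X i).
  by rewrite elem_sym2 psum1E /psum fibE.
(* Functions leaving index [i] take values at [ordS i], so [closed_form] pairs [#|X i|] with the sum
   at [ordS i]; this shift turns that into the pairing with [ord_pred]. *)
have reindexS (G : 'I_k -> {fraction vpoly F X}) :
    \prod_i G i = \prod_i G (ordS i).
  exact: (reindex_inj (can_inj (@ordSK k))).
rewrite EC_poly_closed_form // /closed_form rmorphB !rmorph_prod /= mulrBr.
congr (_ - _).
  rewrite -big_split [RHS]reindexS /=; apply: eq_bigr => i _.
  rewrite psum1_e1 rmorphXn ordSK fibE card_fib !exprnP -expfzDr //.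
  by rewrite subrK.
rewrite [X in _ = X * _]reindexS [X in _ * (_ * X)]reindexS.
rewrite (_ : 2 ^+ k = \prod_(i < k) 2); last by rewrite prodr_const card_ord.
rewrite -!big_split /=.
(* A singleton makes both products vanish through its [e 2]. Otherwise all sizes are at least two,
   and the truncated exponents agree with the integer ones. *)
have [/existsP[i Xi]|/existsPn X_gt1] := boolP [exists i, (#|X (ordS i)| < 2)%N].
  have e2_0 : elem_sym F 2 (vertices_of X (ordS i)) = 0.
    by rewrite elem_sym_eq0 ?card_fib.
  rewrite (bigD1 i) //= psum2_e2 e2_0 mulr0 mulr0 rmorph0 mul0r.
  by rewrite [RHS](bigD1 i) //= /e e2_0 rmorph0 !mulr0 mul0r.
apply: eq_bigr => i _.
rewrite psum2_e2 psum1_e1 ordSK fibE card_fib rmorphM rmorphXn rmorphM rmorph_nat.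
congr (_ * _); rewrite /n subzn //.
by rewrite -(ord_predK i) leqNgt X_gt1.
Qed.
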